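(* Let $(X,Y,c)$ be a dual system, $Z:=X\times Y$, let $G\subset Z$ be non-empty, and let $S\subset Z$ be non-empty, dissipative, and convex. Let $\beta$ be a Hausdorff topology on $S$ such that $(S,\beta)$ is compact. Consider the conditions: (USC1) for every $g\in\operatorname{conv}G$, the function $(S,\beta)\ni s\mapsto c(g-s)\in\mathbb{R}$ is upper semicontinuous; (USC2) $c:(S,\beta)\to\mathbb{R}$ is upper semicontinuous and $\beta$ is stronger than $\sigma(Z,G)$ on $S$; (USC3) $\beta$ is stronger than $\sigma(Z,G\cup S)$ on $S$. Then (USC3) $\Rightarrow$ (USC2) $\Rightarrow$ (USC1). Moreover, if (USC1) holds and $$\forall g\in\operatorname{conv}G,\ \exists s\in S,\quad (\operatorname{conv}c_{G}-c)(g)+c(g-s)\ge0,$$ then $G^{+}\cap S\neq\emptyset$.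
   Context: A dual system $(X,Y,c=\langle\cdot,\cdot\rangle)$ consists of real vector spaces $X,Y$ and a bilinear form $\langle\cdot,\cdot\rangle:X\times Y\to\mathbb{R}$; no separation is assumed. Put $Z:=X\times Y$ and $c(x,y):=\langle x,y\rangle$; for $z=(x,y)$, $w=(u,v)$ in $Z$, $z\cdot w:=\langle x,v\rangle+\langle u,y\rangle$. For $\emptyset\neq B\subset Z$, $\sigma(Z,B)$ is the weakest topology on $Z$ making all linear forms $z\mapsto z\cdot b$, $b\in B$, continuous. ''$\beta$ is stronger than $\sigma$ on $S$'' means that $\beta$ contains the trace of $\sigma$ on $S$ (not necessarily strictly). $\beta$ is not assumed to be related to the linear structure. A set $S\subset Z$ is dissipative if $c(s_1-s_2)\le 0$ for all $s_1,s_2\in S$. $G^{+}:=\{z\in Z\mid c(z-g)\ge 0\ \forall g\in G\}$. $c_G:Z\to\mathbb{R}\cup\{+\infty\}$ equals $c$ on $G$ and $+\infty$ off $G$. $\operatorname{conv}c_G:Z\to[-\infty,+\infty]$ is the greatest convex function not exceeding $c_G$, i.e. $(\operatorname{conv}c_G)(z)=\inf\{\sum_{k=1}^n\lambda_k c(g_k)\mid n\ge1,\ g_k\in G,\ \lambda_k\ge0,\ \sum\lambda_k=1,\ \sum\lambda_kg_k=z\}$, with $\inf\emptyset=+\infty$ (the value $-\infty$ is possible). *)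

(* Defs.v *)
From HB Require Import structures.
From mathcomp Require Import all_boot all_order all_algebra.
From mathcomp Require Import all_classical all_reals all_analysis.
Import numFieldNormedType.Exports.

Set Implicit Arguments.
Unset Strict Implicit.
Unset Printing Implicit Defensive.

Import Order.TTheory GRing.Theory Num.Theory.
Local Open Scope classical_set_scope.
Local Open Scope ring_scope.

(* The library only has lower semicontinuity, for \bar R-valued functions. *)
Definition upper_semicontinuous {R : numFieldType} {T : topologicalType}
    (f : T -> R) :=
  forall x a, f x < a -> \forall y \near x, f y < a.

Definition convex_hull {R : numDomainType} {M : lmodType R} (A : set M) :
    set M :=
  smallest (@convex_set R M) A.

Section dual_system.
Context {R : realType} {X Y : lmodType R}.
(* A dual system: no separation of points is required. *)
Variable b : {bilinear X -> Y -> R | *%R & *%R}.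
Local Notation Z := (X * Y)%type.
Implicit Types (z w : Z) (B G S : set Z).

Definition coupling z : R := b z.1 z.2.
Local Notation c := coupling.

Definition zdot z w : R := b z.1 w.2 + b w.1 z.2.

(* sigma(Z, B): the coarsest topology on Z making z |-> zdot z v continuous for
   every v in B, as the supremum of the topologies induced by these forms. *)
Definition sigma_topology B : topologicalType :=
  sup_topology (fun v : B =>
    Topological.class (initial_topology (fun z => zdot z (set_val v)))).

(* beta : Topological S is an arbitrary topology on the points of S (library
   convention of sup_topology), and Topological.Pack beta the space (S, beta).
   The condition says that beta contains the trace of sigma(Z, B) on S. *)
Definition stronger_on S (beta : Topological S) B :=
  forall U : set (sigma_topology B), open U ->
    @open (Topological.Pack beta) [set s : S | U (set_val s)].

Definition dissipative S :=
  forall s1 s2, S s1 -> S s2 -> c (s1 - s2) <= 0.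

Definition plus_polar G : set Z :=
  [set z | forall g, G g -> 0 <= c (z - g)].

(* conv c_G, the greatest convex function not exceeding c_G (equal to c on G
   and to +oo off G), through its explicit formula; ereal_inf set0 = +oo. *)
Definition conv_c G z : \bar R :=
  ereal_inf [set r | exists (n : nat) (l : 'I_n.+1 -> R) (g : 'I_n.+1 -> Z),
    [/\ forall k, G (g k), forall k, 0 <= l k, \sum_k l k = 1,
        \sum_k l k *: g k = z & r = (\sum_k l k * c (g k))%:E]].

Definition USC1 G S (beta : Topological S) :=
  forall g, convex_hull G g ->
    @upper_semicontinuous R (Topological.Pack beta)
      (fun s : S => c (g - set_val s)).

Definition USC2 G S (beta : Topological S) :=
  @upper_semicontinuous R (Topological.Pack beta) (fun s : S => c (set_val s))
  /\ stronger_on beta G.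

Definition USC3 G S (beta : Topological S) :=
  stronger_on beta (G `|` S).

End dual_system.

(* Main.v *)
(** On [S] the coupling [c] is concave, because [c (s1 - s2) <= 0]; hence so is
    [s |-> c (g - s)]. By compactness it is enough to find, for finitely many
    [g_i] in [G] and [e_i > 0], a point [s] of [S] with [c (g_i - s) > - e_i]
    for all [i]. If there is none, a theorem of the alternative for concave
    functions, which is purely algebraic, yields convex weights [l_i] with
    [\sum_i l_i (c (g_i - s) + e_i) <= 0] on [S]. For [g = \sum_i l_i g_i],
    [\sum_i l_i c (g_i - s)] is at least [(conv c_G - c) g + c (g - s)], which
    is nonnegative for some [s] by hypothesis: a contradiction.

    For (USC3) => (USC2), dissipativity bounds [c s] by [s . s0 - c s0], which
    is sigma(Z, S)-continuous in [s] and equal to [c s0] at [s = s0]. *)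
Require Import Defs.
From mathcomp Require Import all_boot all_order all_algebra finmap.
From mathcomp Require Import all_classical all_reals all_analysis.
From mathcomp Require Import ring lra.
Import numFieldNormedType.Exports.
Import Order.TTheory GRing.Theory Num.Theory.
Local Open Scope classical_set_scope.
Local Open Scope ring_scope.

(** Trades the interval-typed scalars of [convex_set] for a real [t] with explicit bounds. *)
Lemma convex_setP (R : realType) (M : lmodType R) (A : set M) :
  convex_set A <->
  forall (t : R) x y, 0 <= t <= 1 -> A x -> A y -> A (t *: x + (1 - t) *: y).
Proof.
split=> [cA t x y /andP[t0 t1] Ax Ay|cA x y t /set_mem Ax /set_mem Ay].
- have t01 : Itv.spec (@Itv.num_sem R) (Itv.Real `[0, 1]%Z) t.
    by apply/and3P; split; rewrite ?num_real// bnd_simp.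
  exact: set_mem (cA x y (Itv.mk t01) (mem_set Ax) (mem_set Ay)).
- by apply/mem_set/cA => //; rewrite ge0 le1.
Qed.

(** * A theorem of the alternative for finitely many concave functions *)

Section concave_alternative.
Context {R : realType} {M : lmodType R}.
Implicit Types (K : set M) (f h : M -> R).

Definition concave_on K h := forall (t : R) x y, 0 <= t <= 1 -> K x -> K y ->
  t * h x + (1 - t) * h y <= h (t *: x + (1 - t) *: y).

Lemma concave_onW K K' h : K' `<=` K -> concave_on K h -> concave_on K' h.
Proof. by move=> KK' ch t x y t01 /KK' Kx /KK' Ky; exact: ch. Qed.

Lemma concave_on_sum K n (h : 'I_n -> M -> R) (l : 'I_n -> R) :
  (forall i, 0 <= l i) -> (forall i, concave_on K (h i)) ->
  concave_on K (fun x => \sum_i l i * h i x).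
Proof.
move=> l0 ch t x y t01 Kx Ky; rewrite !mulr_sumr -big_split/=.
apply: ler_sum => i _; rewrite mulrCA (mulrCA (1 - t)) -mulrDr.
by apply: ler_wpM2l => //; exact: ch.
Qed.

Lemma convex_set_concave_gt0 K h : convex_set K -> concave_on K h ->
  convex_set (K `&` [set x | 0 < h x]).
Proof.
move=> /convex_setP cK ch; apply/convex_setP => t x y t01 [Kx hx] [Ky hy].
split; first exact: cK.
apply: lt_le_trans (ch _ _ _ t01 Kx Ky); case/andP: t01 => t0 t1.
have [->|tn0] := eqVneq t 0; first by rewrite mul0r add0r subr0 mul1r.
by apply: ltr_wpDr; [rewrite mulr_ge0 ?subr_ge0// ltW|
  rewrite mulr_gt0// lt_neqAle eq_sym tn0].
Qed.

(** If [h] or [f] is nowhere positive on [K], the weight [m] is 1 or 0. Otherwise some [k >= 0]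
    satisfies [k * h x + f x <= 0] on [K], and normalizing the weights [k] and 1 gives [m]. *)
Lemma concave_alternative2 K f h : convex_set K ->
  concave_on K f -> concave_on K h ->
  (forall x, K x -> 0 < h x -> f x <= 0) ->
  exists2 m : R, 0 <= m <= 1 &
    forall x, K x -> m * h x + (1 - m) * f x <= 0.
Proof.
move=> /convex_setP cK cf ch fh.
have [[b [Kb hb]]|nB] := pselect (exists b, K b /\ 0 < h b); last first.
  exists 1 => [|x Kx]; first by rewrite ler01 lexx.
  rewrite mul1r subrr mul0r addr0 leNgt; apply/negP => hx.
  by apply: nB; exists x.
(* Otherwise f and h are both positive at the point of the segment [a, d] with
   weights proportional to h d - f d and f a - h a. *)
have cross a d : K a -> K d -> 0 < f a -> 0 < h d -> f a * h d <= h a * f d.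
  move=> Ka Kd fa hd; rewrite leNgt; apply/negP => lt.
  have fd : f d <= 0 by exact: fh.
  have ha : h a <= 0.
    by rewrite leNgt; apply/negP => ha; have := fh _ Ka ha; rewrite leNgt fa.
  pose u := h d - f d; pose v := f a - h a.
  have uv0 : 0 < u + v by rewrite /u /v; lra.
  have t01 : 0 <= u / (u + v) <= 1.
    by rewrite ler_pdivlMr// ler_pdivrMr// mul0r mul1r /u /v; lra.
  have tE : 1 - u / (u + v) = v / (u + v) by field; exact: lt0r_neq0.
  have pos r1 r2 : 0 < u * r1 + v * r2 ->
      0 < u / (u + v) * r1 + (1 - u / (u + v)) * r2.
    move=> ?; rewrite tE (_ : _ + _ = (u * r1 + v * r2) / (u + v)).
      by rewrite divr_gt0.
    by field; exact: lt0r_neq0.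
  (* Both [u * f a + v * f d] and [u * h a + v * h d] equal [f a * h d - h a * f d], which [lt]
     makes positive. *)
  have fx : 0 < f (u / (u + v) *: a + (1 - u / (u + v)) *: d).
    by apply: lt_le_trans (cf _ _ _ t01 Ka Kd); apply: pos; rewrite /u /v; lra.
  have hx : 0 < h (u / (u + v) *: a + (1 - u / (u + v)) *: d).
    by apply: lt_le_trans (ch _ _ _ t01 Ka Kd); apply: pos; rewrite /u /v; lra.
  by have := fh _ (cK _ _ _ t01 Ka Kd) hx; rewrite leNgt fx.
have [[a0 [Ka0 fa0]]|nA] := pselect (exists a, K a /\ 0 < f a); last first.
  exists 0 => [|x Kx]; first by rewrite lexx ler01.
  rewrite mul0r add0r subr0 mul1r leNgt; apply/negP => fx.
  by apply: nA; exists x.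
have hneg a : K a -> 0 < f a -> h a < 0.
  move=> Ka fa; have ha : h a <= 0.
    by rewrite leNgt; apply/negP => ha; have := fh _ Ka ha; rewrite leNgt fa.
  rewrite lt_neqAle ha andbT; apply/eqP => ha0.
  by have := cross _ _ Ka Kb fa hb; rewrite ha0 mul0r leNgt mulr_gt0.
(* Points with [f > 0] bound [k] from below by the elements of [E], points with [h > 0] bound it
   from above by [- f d / h d]. By [cross] these bounds are compatible, so [k = sup E] works. *)
pose E := [set f a / - h a | a in K `&` [set a | 0 < f a]].
have ubE d : K d -> 0 < h d -> ubound E (- f d / h d).
  move=> Kd hd _ [a [Ka fa] <-]; have ha := hneg _ Ka fa.
  rewrite ler_pdivrMr ?oppr_gt0// mulrAC ler_pdivlMr// mulrNN [leRHS]mulrC.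
  exact: cross.
have supE : has_sup E.
  by split; [exists (f a0 / - h a0), a0|exists (- f b / h b); exact: ubE].
have k0 : 0 <= sup E.
  apply: (@le_trans _ _ (f a0 / - h a0)).
    by rewrite divr_ge0// ?oppr_ge0 ltW// hneg.
  by apply: ub_le_sup; [exact: supE.2|exists a0].
have k10 : 0 < 1 + sup E by rewrite ltr_pwDl.
exists (sup E / (1 + sup E)) => [|x Kx].
  by rewrite ler_pdivlMr// ler_pdivrMr// mul0r mul1r k0/= lerDr.
rewrite [leLHS](_ : _ = (sup E * h x + f x) / (1 + sup E)); last first.
  by field; exact: lt0r_neq0.
rewrite ler_pdivrMr// mul0r.
have [hx|hx] := ltP 0 (h x).
  rewrite -lerBrDr sub0r -ler_pdivlMr//.
  by apply: ge_sup; [exact: supE.1|exact: ubE].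
have [fx|fx] := ltP 0 (f x); last by rewrite -[leRHS]addr0 lerD// mulr_ge0_le0.
have hx0 := hneg _ Kx fx.
rewrite -lerBrDl sub0r -mulrN -ler_pdivrMr ?oppr_gt0//.
by apply: ub_le_sup; [exact: supE.2|exists x].
Qed.

(** Induction on the number of functions: the hypothesis is applied to all but the first on the part
    of [K] where the first is positive. The two-function case then combines the resulting weighted
    sum with the first function on all of [K]. *)
Lemma concave_alternative K n (h : 'I_n.+1 -> M -> R) :
  convex_set K -> (forall i, concave_on K (h i)) ->
  (forall x, K x -> exists i, h i x <= 0) ->
  exists l : 'I_n.+1 -> R, [/\ forall i, 0 <= l i, \sum_i l i = 1 &
    forall x, K x -> \sum_i l i * h i x <= 0].
Proof.
elim: n K h => [|n IHn] K h cK ch h0.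
  exists (fun=> 1); split=> [i||x Kx]; rewrite ?big_ord1//.
  by have [i] := h0 _ Kx; rewrite mul1r (ord1 i).
have [|i|x [Kx h0x]|l [l0 l1 lh]] := IHn (K `&` [set x | 0 < h ord0 x])
    (fun i => h (lift ord0 i)).
- exact: convex_set_concave_gt0.
- by apply: concave_onW (ch _) => x [].
- have [i] := h0 _ Kx; case: (unliftP ord0 i) => [j|] ->; first by exists j.
  by rewrite leNgt h0x.
have [|x Kx hx|m /andP[m0 m1] mh] := @concave_alternative2 K
    (fun x => \sum_i l i * h (lift ord0 i) x) (h ord0) cK _ (ch _).
- by apply: concave_on_sum.
- exact: lh.
exists (fun i => if unlift ord0 i is Some j then (1 - m) * l j else m); split.
- by move=> i; case: unliftP => // j _; rewrite mulr_ge0// subr_ge0.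
- rewrite big_ord_recl unlift_none (eq_bigr (fun i => (1 - m) * l i)).
    by rewrite -mulr_sumr l1 mulr1 addrC subrK.
  by move=> i _; rewrite liftK.
- move=> x Kx; rewrite big_ord_recl unlift_none.
  rewrite (eq_bigr (fun i => (1 - m) * (l i * h (lift ord0 i) x))).
    by rewrite -mulr_sumr; exact: mh.
  by move=> i _; rewrite liftK mulrA.
Qed.

End concave_alternative.

(** * Algebra of the coupling and its concavity on dissipative sets *)

Section dual_system.
Context {R : realType} {X Y : lmodType R}.
Variable b : {bilinear X -> Y -> R | *%R & *%R}.
Local Notation Z := (X * Y)%type.
Local Notation c := (coupling b).
Implicit Types (z w : Z) (B G S : set Z).

Lemma zdotC z w : zdot b z w = zdot b w z.
Proof. by rewrite /zdot addrC. Qed.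

Lemma zdotDl z1 z2 w : zdot b (z1 + z2) w = zdot b z1 w + zdot b z2 w.
Proof. by rewrite /zdot/= linearDl linearDr/= addrACA. Qed.

Lemma zdotZl a z w : zdot b (a *: z) w = a * zdot b z w.
Proof. by rewrite /zdot/= linearZl_LR linearZr_LR/= mulrDr. Qed.

Lemma zdot_suml n (l : 'I_n -> R) (g : 'I_n -> Z) w :
  zdot b (\sum_i l i *: g i) w = \sum_i l i * zdot b (g i) w.
Proof.
elim/big_ind2: _ => [|x1 x2 y1 y2 <- <-|i _]; last exact: zdotZl.
  by rewrite -(scale0r w) zdotZl mul0r.
exact: zdotDl.
Qed.

Lemma couplingB z w : c (z - w) = c z - zdot b z w + c w.
Proof.
rewrite /coupling /zdot/= linearBl !linearBr/=; ring.
Qed.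

Lemma couplingBC z w : c (z - w) = c (w - z).
Proof. by rewrite !couplingB (zdotC w z); ring. Qed.

Lemma coupling_conv (t : R) z w : c (t *: z + (1 - t) *: w) =
  t * c z + (1 - t) * c w - t * (1 - t) * c (z - w).
Proof.
rewrite couplingB /coupling /zdot/= linearDl !linearDr/=.
rewrite !(linearZl_LR, linearZr_LR)/= /GRing.scale/=; ring.
Qed.

(** Up to terms affine in [s], [c (g - s)] is the quadratic form [c s], whose concavity defect
    between [x] and [y] is a nonnegative multiple of [- c (x - y)]. *)
Lemma dissipative_concave S g : dissipative b S ->
  concave_on S (fun s => c (g - s)).
Proof.
move=> dS t x y /andP[t0 t1] Sx Sy; rewrite !couplingB coupling_conv.
rewrite (zdotC g (_ + _)) zdotDl !zdotZl !(zdotC _ g).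
have : 0 <= t * (1 - t) * - c (x - y).
  by rewrite !mulr_ge0 ?subr_ge0 ?oppr_ge0//; exact: dS.
lra.
Qed.

Lemma conv_c_fin_le n (l : 'I_n.+1 -> R) (g : 'I_n.+1 -> Z) G :
  (forall k, G (g k)) -> (forall k, 0 <= l k) -> \sum_k l k = 1 ->
  (conv_c b G (\sum_k l k *: g k)%R <= (\sum_k l k * c (g k))%:E)%E.
Proof. by move=> Gg l0 l1; apply: ereal_inf_lbound; exists n, l, g. Qed.

(** Since the weights sum to 1, both sides have the same terms in [s]: [- zdot z s + c s]. *)
Lemma coupling_sumB n (l : 'I_n -> R) (g : 'I_n -> Z) s : \sum_k l k = 1 ->
  let z := \sum_k l k *: g k in
  \sum_k l k * c (g k - s) = (\sum_k l k * c (g k) - c z) + c (z - s).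
Proof.
move=> l1 z; rewrite couplingB zdot_suml.
rewrite (eq_bigr (fun k => l k * c (g k) - l k * zdot b (g k) s + l k * c s)).
  by rewrite big_split/= sumrB -mulr_suml l1; ring.
by move=> k _; rewrite couplingB; ring.
Qed.

(** * Comparison of topologies and the implications between the semicontinuity conditions *)

Section topology_on_S.
Context {S : set Z} (beta : Topological S).
Local Notation betaS := (Topological.Pack beta).

Lemma stronger_onP B : stronger_on b beta B <->
  forall v, B v -> continuous (fun s : betaS => zdot b (set_val s) v).
Proof.
split=> [sB v Bv|cB U].
- apply/continuousP => A oA.
  apply: (sB (fun z => A (zdot b z v))).
  (* An open set of a supremum topology is a union of finite intersections of subbasic sets; here
     one set suffices. *)
  exists [set [set z | A (zdot b z v)]]; last by rewrite bigcup_set1.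
  move=> _ ->; exists (fset1 [set z | A (zdot b z v)]).
    move=> _ /fset1P ->; apply/mem_set; exists (exist _ v (mem_set Bv)) => //.
    by exists A.
  by rewrite set_fset1 bigcap_set1.
- suff cval : continuous (set_val : betaS -> sigma_topology b B).
    by move=> oU; move/continuousP: cval => /(_ U oU).
  move=> s; apply/cvg_sup => v.
  apply: (@continuous_comp_initial _ betaS _ _ set_val).
  exact/cB/set_valP.
Qed.

Lemma stronger_onW B B' : B `<=` B' ->
  stronger_on b beta B' -> stronger_on b beta B.
Proof. by move=> BB' /stronger_onP sB; apply/stronger_onP => v /BB' /sB. Qed.

(** The vectors [v] whose form is continuous on [S] form a convex set containing [B]. *)
Lemma stronger_on_convex_hull B : stronger_on b beta B ->
  stronger_on b beta (convex_hull B).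
Proof.
move=> /stronger_onP sB; apply/(stronger_onP (convex_hull B)).
pose P := [set v | continuous (fun s : betaS => zdot b (set_val s) v)].
suff cP : convex_set P by exact: (smallest_sub cP sB).
apply/convex_setP => t v w _ cv cw s.
rewrite /P/= [X in continuous_at _ X](_ : _ = fun s : betaS =>
  t * zdot b (set_val s) v + (1 - t) * zdot b (set_val s) w); last first.
  by apply/funext => r; rewrite zdotC zdotDl !zdotZl !(zdotC _ (set_val _)).
by apply: cvgD; apply: cvgMr; [exact: cv|exact: cw].
Qed.

Lemma USC3_USC2 G : dissipative b S -> USC3 b G beta -> USC2 b G beta.
Proof.
move=> dS sGS; split; last by apply: stronger_onW sGS => z; left.
move=> s0 a csa.
have Ss (r : S) : S (set_val r) by exact: set_valP.
have /stronger_onP/(_ _ (or_intror (Ss s0))) cs0 := sGS.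
have tangent (s : S) :
    c (set_val s) <= zdot b (set_val s) (set_val s0) - c (set_val s0).
  by have := dS _ _ (Ss s) (Ss s0); rewrite couplingB; lra.
have zs0 : zdot b (set_val s0) (set_val s0) = c (set_val s0) + c (set_val s0).
  by rewrite /zdot /coupling.
near=> s; apply: le_lt_trans (tangent s) _; rewrite ltrBlDr.
near: s; apply: cvgr_lt (cs0 s0) _ _.
by rewrite zs0 ltrD2r.
Unshelve. all: by end_near. Qed.

Lemma USC2_USC1 G : USC2 b G beta -> USC1 b G beta.
Proof.
move=> [uc /stronger_on_convex_hull/stronger_onP sG] g /sG cg s0 a.
rewrite couplingB => ca.
(* Half of the gap: one [e] is spent on [c s], the other on [zdot s g]. *)
pose e := (a - (c g - zdot b g (set_val s0) + c (set_val s0))) / 2.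
have e0 : 0 < e by rewrite divr_gt0// subr_gt0.
near=> s; rewrite couplingB.
have h1 : c (set_val s) < c (set_val s0) + e.
  by near: s; apply: uc; rewrite ltrDl.
have h2 : zdot b (set_val s0) g - e < zdot b (set_val s) g.
  near: s; apply: cvgr_gt (cg s0) _ _.
  by rewrite gtrBl.
move: h1 h2; rewrite /e !(zdotC _ g); lra.
Unshelve. all: by end_near. Qed.

End topology_on_S.

(** * Approximate solutions for finite families, and passage to the limit by compactness *)

Lemma convex_hull_sum n (l : 'I_n.+1 -> R) (g : 'I_n.+1 -> Z) G :
  (forall k, G (g k)) -> (forall k, 0 <= l k) -> \sum_k l k = 1 ->
  convex_hull G (\sum_k l k *: g k).
Proof.
move=> Gg l0 l1 A [/convex_setP cA GA].
elim: n l g Gg l0 l1 => [|n IHn] l g Gg l0 l1.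
  by move: l1; rewrite !big_ord1 => ->; rewrite scale1r; apply/GA/Gg.
move: l1; rewrite big_ord_recl; set m := \sum_i _ => l1.
rewrite big_ord_recl.
have m0 : 0 <= m by exact: sumr_ge0.
have t01 : 0 <= l ord0 <= 1 by rewrite l0/= -l1 lerDl.
have mE : m = 1 - l ord0 by rewrite -l1 addrAC subrr add0r.
(* The tail is rescaled to total weight 1 by dividing by [m]; when [m = 0] all its weights
   vanish. *)
have [m_eq0|mneq0] := eqVneq m 0.
  rewrite big1 => [|k _]; last first.
    by rewrite (psumr_eq0P _ m_eq0) ?scale0r// => i _.
  move: l1; rewrite m_eq0 !addr0 => ->; rewrite scale1r; exact/GA/Gg.
rewrite (_ : \sum_(k < n.+1) _ = (1 - l ord0) *:
    \sum_k (l (lift ord0 k) / m) *: g (lift ord0 k)); last first.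
  rewrite -mE scaler_sumr; apply: eq_bigr => k _.
  by rewrite scalerA mulrCA divff// mulr1.
apply: cA => //; first exact/GA/Gg.
apply: IHn => // [k|]; first by rewrite divr_ge0.
by rewrite -mulr_suml divff.
Qed.

Lemma plus_polar_approx n (g : 'I_n.+1 -> Z) (e : 'I_n.+1 -> R) G S :
  dissipative b S -> convex_set S ->
  (forall g, convex_hull G g -> exists2 s, S s &
     (0 <= (conv_c b G g - (c g)%:E) + (c (g - s))%:E)%E) ->
  (forall k, G (g k)) -> (forall k, 0 < e k) ->
  exists2 s, S s & forall k, - e k < c (g k - s).
Proof.
move=> dS cS hS Gg e0; apply: contrapT => nex.
pose h k s := c (g k - s) + e k.
have ch k : concave_on S (h k).
  move=> t x y t01 Sx Sy.
  by have := dissipative_concave S (g k) dS t x y t01 Sx Sy; rewrite /h; lra.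
have [s Ss|l [l0 l1 lh]] := concave_alternative _ _ _ cS ch.
  apply: contrapT => hs; apply: nex; exists s => // k.
  by rewrite ltNge; apply/negP => hk; apply: hs; exists k; rewrite /h; lra.
have [s Ss] := hS _ (convex_hull_sum _ _ _ _ Gg l0 l1).
apply/negP; rewrite -ltNge.
(* [conv_c] may be [-oo] here, so the computation stays in the extended reals until [conv_c] is
   replaced by the finite sum above it. *)
apply: (@le_lt_trans _ _ (\sum_k l k * c (g k - s))%:E).
  rewrite coupling_sumB// EFinD EFinB leeD2r// leeB//.
  exact: conv_c_fin_le.
rewrite lte_fin.
(* This strict inequality, together with [lh], makes the sum of the [l k * c (g k - s)] negative. *)
have le0 : 0 < \sum_k l k * e k.
  have le_ge0 k : xpredT k -> 0 <= l k * e k by rewrite mulr_ge0// ltW.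
  rewrite lt_neqAle eq_sym sumr_ge0// andbT; apply/negP => /eqP le_eq0.
  have : \sum_k l k = 0.
    apply: big1 => k _; apply/eqP.
    have /eqP : l k * e k = 0 by exact: (psumr_eq0P le_ge0 le_eq0).
    by rewrite mulf_eq0 (gt_eqF (e0 k)) orbF.
  by rewrite l1 => /eqP; rewrite oner_eq0.
have := lh _ Ss; rewrite (eq_bigr (fun k => l k * c (g k - s) + l k * e k)).
  by rewrite big_split/=; lra.
by move=> k _; rewrite mulrDr.
Qed.

(** The sets [f (g, e)] have the finite intersection property, so the filter they generate has a
    cluster point [p]. If [c (g - p) < 0], upper semicontinuity gives a neighbourhood of [p] missing
    some [f (g, e)]. *)
Lemma plus_polarI_neq0 G S (beta : Topological S) : S !=set0 ->
  dissipative b S -> convex_set S -> compact [set: Topological.Pack beta] ->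
  USC1 b G beta ->
  (forall g, convex_hull G g -> exists2 s, S s &
     (0 <= (conv_c b G g - (c g)%:E) + (c (g - s))%:E)%E) ->
  plus_polar b G `&` S !=set0.
Proof.
move=> S0 dS cS comp usc hS.
pose D : set (Z * R) := [set i | G i.1 /\ 0 < i.2].
pose f (i : Z * R) : set (Topological.Pack beta) :=
  [set s | - i.2 < c (i.1 - set_val s)].
have finf : finI D f.
  move=> D' D'D.
  have {}D'D i : i \in D' -> D i by move=> /D'D /set_mem.
  have memD' i : (i \in D') = (i \in enum_fset D') by [].
  (* The approximation lemma takes a nonempty family; for the empty one any point of [S] will do. *)
  case E : (enum_fset D') memD' => [|x r] memD'.
    have [s Ss] := S0; exists (exist _ s (mem_set Ss)) => i /=.
    by rewrite memD'.
  pose n := size r.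
  have nthD (k : 'I_n.+1) : D (nth x (x :: r) k).
    by apply: D'D; rewrite memD' mem_nth.
  have [s Ss hs] := plus_polar_approx _ _ _ _ _ dS cS hS
    (fun k => (nthD k).1) (fun k => (nthD k).2).
  exists (exist _ s (mem_set Ss)) => i /=.
  rewrite memD' => ir.
  have := hs (Ordinal (etrans (index_mem _ _) ir : index i (x :: r) < n.+1)%N).
  by rewrite /= nth_index.
have Ff := finI_filter finf.
have [|p [_ clp]] := comp _ Ff; first exact: filterT.
exists (set_val p); split; last exact: set_valP.
move=> g Gg; rewrite couplingBC leNgt; apply/negP => cgp.
have [e e0 ue] : exists2 e : R, 0 < e & c (g - set_val p) < - e.
  by exists (- c (g - set_val p) / 2); lra.
have fge : filter_from (finI_from D f) id (f (g, e)).
  by exists (f (g, e)) => //; apply: finI_from1.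
have [s [/= fs us]] := clp _ _ fge (usc _ (sub_gen_smallest Gg) p _ ue).
by move: fs; rewrite /f/= ltNge ltW.
Qed.

End dual_system.

Theorem theorem18 (R : realType) (X Y : lmodType R)
    (b : {bilinear X -> Y -> R | *%R & *%R})
    (G S : set (X * Y)) (G_neq0 : G !=set0)
    (S_neq0 : S !=set0) (S_dissipative : dissipative b S)
    (S_convex : convex_set S)
    (beta : Topological S)
    (beta_hausdorff : hausdorff_space (Topological.Pack beta))
    (beta_compact : compact [set: Topological.Pack beta]) :
  [/\ USC3 b G beta -> USC2 b G beta,
      USC2 b G beta -> USC1 b G beta &
      USC1 b G beta ->
      (forall g, convex_hull G g -> exists2 s, S s &
         (0 <= (conv_c b G g - (coupling b g)%:E) + (coupling b (g - s))%:E)%E) ->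
      plus_polar b G `&` S !=set0].
Proof.
split.
- exact: USC3_USC2.
- exact: USC2_USC1.
- exact: plus_polarI_neq0.
Qed.
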